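(* Let $0<\epsilon<1$ be a constant. Let $T$ be a tree on $n$ vertices of maximum degree $\Delta$ (both $T=T_n$ and $\Delta=\Delta(n)$ may depend on $n$), and let $p=p(n)\in[0,1]$ satisfy $$np\ge \frac{40}{\epsilon}\,\Delta\ln n+n^{\epsilon}.$$ Then with high probability the random graph $G(n,p)$ contains a copy of $T$ (i.e. a subgraph isomorphic to $T$, necessarily spanning). Explicitly: for every $0<\epsilon<1$ and every $\eta>0$ there exists $n_0$ such that for all $n\ge n_0$, every tree $T$ on $n$ vertices with maximum degree $\Delta$, and every $p\in[0,1]$ satisfying the displayed inequality, the probability that $G(n,p)$ contains a copy of $T$ is at least $1-\eta$.
   Context: $G(n,p)$ is the binomial random graph on vertex set $[n]=\{1,\ldots,n\}$, in which each of the $\binom n2$ pairs is an edge independently with probability $p$. An event holds with high probability if its probability tends to $1$ as $n\to\infty$. $\ln$ is the natural logarithm. *)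

(* Defs.v *)
From HB Require Import structures.
From mathcomp Require Import all_boot all_order all_algebra.
From mathcomp Require Export reals exp.

Set Implicit Arguments.
Unset Strict Implicit.
Unset Printing Implicit Defensive.

Import Order.TTheory GRing.Theory Num.Theory.

Definition pairs (V : finType) : {set {set V}} := [set e : {set V} | #|e| == 2].

(* A simple graph on V is a set of unordered pairs of distinct vertices. *)
Record sgraph (V : finType) :=
  SGraph { edges : {set {set V}}; edges_pairs : edges \subset pairs V }.

HB.instance Definition _ (V : finType) := [isSub for @edges V].
HB.instance Definition _ (V : finType) := [Finite of sgraph V by <:].

Definition adj (V : finType) (G : sgraph V) : rel V :=
  fun x y => [set x; y] \in edges G.

Definition connected (V : finType) (G : sgraph V) : Prop :=
  (0 < #|V|) /\ forall x y : V, connect (adj G) x y.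

(* The size bound is needed: [ucycle] also accepts the empty sequence and
   x, y traversed back and forth along a single edge. *)
Definition acyclic (V : finType) (G : sgraph V) : Prop :=
  forall c : seq V, 2 < size c -> ~ ucycle (adj G) c.

Definition tree (V : finType) (G : sgraph V) : Prop :=
  connected G /\ acyclic G.

Definition degree (V : finType) (G : sgraph V) (x : V) : nat :=
  #|[set y | adj G x y]|.

Definition max_degree (V : finType) (G : sgraph V) : nat :=
  \max_(x : V) degree G x.

(* The copy is the image of H under an injection f of the vertices; it need
   not be an induced subgraph of G. *)
Definition contains_copy (V W : finType) (H : sgraph V) (G : sgraph W) : bool :=
  [exists f : {ffun V -> W},
     injectiveb f && ([set f @: (e : {set V}) | e in edges H] \subset edges G)].

Local Open Scope ring_scope.

(* Independent edges: the law of G(n, p) is a product of Bernoulli(p) weights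
   over all pairs. *)
Definition gnp_mass (R : realType) (n : nat) (p : R) (G : sgraph 'I_n) : R :=
  \prod_(e in pairs 'I_n) (if e \in edges G then p else 1 - p).

Definition gnp_prob (R : realType) (n : nat) (p : R)
    (A : pred (sgraph 'I_n)) : R :=
  \sum_(G | A G) gnp_mass p G.

Lemma gnp_probT (R : realType) (n : nat) (p : R) :
  gnp_prob p (fun _ : sgraph 'I_n => true) = 1.
Proof.
pose D := pairs 'I_n.
pose g (e : {set 'I_n}) (b : bool) : R :=
  if e \in D then (if b then p else 1 - p) else (~~ b)%:R.
have all1 : \prod_e (g e true + g e false) = 1 :> R.
  rewrite big1 // => e _; rewrite /g; case: ifP => _; first by rewrite addrC subrK.
  by rewrite add0r.
rewrite -[RHS]all1 bigA_distr /=.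
rewrite (bigID (fun J : {set {set 'I_n}} => J \subset D)) /=.
rewrite [X in _ = _ + X]big1 ?addr0; last first.
  move=> J /subsetPn[e eJ eD].
  by rewrite (bigD1 e) //= eJ /g (negPf eD) mul0r.
rewrite /gnp_prob [RHS](reindex_omap (@edges 'I_n) insub) /=; last first.
  by move=> J JD; rewrite insubT.
apply: eq_big => [G|G _]; first by rewrite valK eqxx edges_pairs.
rewrite /gnp_mass big_mkcond /=; apply: eq_bigr => e _.
rewrite /g -/D; case: ifP => eD; first by case: ifP.
by case: ifP => // eG; have := subsetP (edges_pairs G) _ eG; rewrite -/D eD.
Qed.

(* Main.v *)
Require Import Defs.
From mathcomp Require Import all_boot all_order all_algebra.
From mathcomp Require Import reals exp.
From mathcomp Require Import lra ring zify.
Set Implicit Arguments.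
Unset Strict Implicit.
Unset Printing Implicit Defensive.
Import Order.TTheory GRing.Theory Num.Theory.
Local Open Scope ring_scope.

(* A uniformly random copy of T contains a given forest with s edges with
   probability at most (3 D / n) ^ s, where D := max (Delta, 6).  Covers of the
   family of copies by edge sets U weighted (3 D / n) ^ #|U| therefore have
   total weight at least 1.  As in Park and Pham's proof of the Kahn-Kalai
   conjecture, expose the random graph in rounds of density 18 D / n: given the
   set W exposed so far, the minimal fragments S :\: W of the family that have
   more than half of the current maximal size have small expected total weight,
   so discarding them costs little, and the others form the family of the next
   round.  Since ln 2 >= 1 / 2, at most 2 ln n rounds leave fragments of bounded
   size, and a last round of density 3 D ln n / n exposes one of these.  The
   total density is at most 39 D ln n / n <= p; the term n ^ eps is only used
   when Delta <= 6. *)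

(** * Random sets and minimal fragments *)

Section Rounds.

Variables (R : realType) (X : finType).
Implicit Types (D W U S : {set X}) (H C : {set {set X}}).

Definition bmass (q : R) D W : R := q ^+ #|W| * (1 - q) ^+ #|D :\: W|.

Definition bprob (q : R) D (P : pred {set X}) : R :=
  \sum_(W : {set X} | W \subset D) bmass q D W * (P W)%:R.

Definition hit H : pred {set X} := fun W => [exists S in H, S \subset W].

Definition covers C H : Prop :=
  forall S, S \in H -> exists2 U, U \in C & U \subset S.

Definition cost (c : R) C : R := \sum_(U in C) c ^+ #|U|.

(** Expand the product over all points of [F e + G e]: outside [D] the factor is [0 + 1], which
    kills every set not inside [D] and contributes 1 otherwise. *)
Lemma sum_subsets D (x y : R) :
  \sum_(W : {set X} | W \subset D) x ^+ #|W| * y ^+ #|D :\: W| = (x + y) ^+ #|D|.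
Proof.
pose F e : R := if e \in D then x else 0.
pose G e : R := if e \in D then y else 1.
have -> : (x + y) ^+ #|D| = \prod_e (F e + G e).
  rewrite -prodr_const big_mkcond /=; apply: eq_bigr => e _.
  by rewrite /F /G; case: ifP => // _; rewrite add0r.
rewrite bigA_distr [RHS](bigID (fun J : {set X} => J \subset D)) /=.
rewrite [X in _ = _ + X]big1 ?addr0; last first.
  by move=> J /subsetPn[e eJ eD]; rewrite (bigD1 e) //= eJ /F (negPf eD) mul0r.
apply: eq_bigr => W WD; rewrite -!prodr_const.
rewrite [X in X * _]big_mkcond [X in _ * X]big_mkcond -big_split /=.
apply: eq_bigr => e _; rewrite /F /G in_setD.
have [eW|eW] := boolP (e \in W); first by rewrite (subsetP WD _ eW) mulr1.
by case: (e \in D); rewrite mul1r.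
Qed.

Lemma bmass_sum q D : \sum_(W : {set X} | W \subset D) bmass q D W = 1.
Proof. by rewrite sum_subsets addrC subrK expr1n. Qed.

Lemma bmass_ge0 q D W : 0 <= q <= 1 -> 0 <= bmass q D W.
Proof.
by move=> /andP[q0 q1]; rewrite mulr_ge0 ?exprn_ge0 // subr_ge0.
Qed.

(** Change of variables [Z = W :|: U]: disjoint pairs inside [D] correspond to pairs [U \subset Z],
    with [W] recovered as [Z :\: U]. *)
Lemma exchange_disjoint D (f : {set X} -> {set X} -> R) :
  \sum_(W : {set X} | W \subset D) \sum_(U : {set X} | U \subset D :\: W) f W U =
  \sum_(Z : {set X} | Z \subset D) \sum_(U : {set X} | U \subset Z) f (Z :\: U) U.
Proof.
rewrite [LHS](exchange_big_dep (fun U => U \subset D)) /=; last first.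
  by move=> W U _ /subset_trans; apply; apply: subsetDl.
rewrite [RHS](exchange_big_dep (fun U => U \subset D)) /=; last first.
  by move=> W U WD /subset_trans; apply.
apply: eq_bigr => U UD.
rewrite (reindex_onto (fun W => W :\: U) (fun W => W :|: U)) /=; last first.
  move=> W /andP[_]; rewrite subsetD => /andP[_ dUW].
  by rewrite setDUl setDv setU0; apply/setDidPl; rewrite disjoint_sym.
apply: eq_bigl => Z.
have -> : (Z :\: U) :|: U == Z = (U \subset Z).
  apply/eqP/idP => [<-|UZ]; first by rewrite subsetUr.
  by rewrite setUC setDE setUIr setUCr setIT; apply/setUidPr.
have [UZ|] := boolP (U \subset Z); rewrite ?andbF ?andbT //.
have -> : U \subset D :\: (Z :\: U).
  by rewrite subsetD UD; apply/pred0P => e /=; rewrite inE; case: (e \in U).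
rewrite andbT; apply/idP/idP => [ZUD|]; last exact/subset_trans/subsetDl.
by rewrite -(setID Z U) subUset ZUD andbT (subset_trans (subsetIr _ _)).
Qed.

(* Exposing first each point with probability q and then each missed point
   with probability r. *)
Lemma bprob_split q r D P :
  bprob (q + (1 - q) * r) D P =
  \sum_(W : {set X} | W \subset D)
    bmass q D W * bprob r (D :\: W) (fun U => P (W :|: U)).
Proof.
under [RHS]eq_bigr do rewrite /bprob mulr_sumr.
rewrite exchange_disjoint.
apply: eq_bigr => Z ZD.
(* For a fixed union [Z], the binomial sum over the second-round part [U] gives the density of the
   combined round; the missed points carry [(1 - q) * (1 - r)]. *)
transitivity (\sum_(U : {set X} | U \subset Z)
   (((1 - q) * r) ^+ #|U| * q ^+ #|Z :\: U|) *
   (((1 - q) * (1 - r)) ^+ #|D :\: Z| * (P Z)%:R)).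
  rewrite -mulr_suml sum_subsets /bmass mulrA addrC; congr (_ * _ ^+ _ * _).
  by ring.
apply: eq_bigr => U UZ; rewrite /bmass.
have -> : Z :\: U :|: U = Z.
  by rewrite setUC setDE setUIr setUCr setIT; apply/setUidPr.
have -> : D :\: (Z :\: U) :\: U = D :\: Z.
  apply/setP => e; rewrite !inE; move/subsetP/(_ e): UZ.
  by case: (e \in U); case: (e \in Z); case: (e \in D) => // ->.
have cD : #|D :\: (Z :\: U)| = (#|D :\: Z| + #|U|)%N.
  have -> : D :\: (Z :\: U) = D :\: Z :|: U.
    by rewrite setDDr; congr (_ :|: _); apply/setIidPr/(subset_trans UZ).
  rewrite cardsU (_ : (D :\: Z) :&: U = set0) ?cards0 ?subn0 //.
  apply/eqP; rewrite setI_eq0 disjoint_sym (disjointWl UZ) //.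
  by rewrite disjoints_subset setCD subsetUr.
by rewrite cD exprD !exprMn; ring.
Qed.

Definition fragments H W : pred {set X} :=
  minset [pred T | T \in [set S :\: W | S in H]].

Definition small_fragments H W l : {set {set X}} :=
  [set U | fragments H W U & (#|U| <= l)%N].

Definition large_fragments H W l : {set {set X}} :=
  [set U | fragments H W U & (l < #|U|)%N].

Lemma fragments_cover H W S : S \in H ->
  exists2 U, fragments H W U & U \subset S.
Proof.
move=> SH; have [|U fU US] :=
  @minset_exists _ [pred T | T \in [set S :\: W | S in H]] (S :\: W).
  exact: (imset_f (fun S => S :\: W) SH).
by exists U => //; apply: subset_trans US (subsetDl _ _).
Qed.

Lemma fragmentE H W U : fragments H W U -> exists2 S, S \in H & U = S :\: W.
Proof. by move/minsetp; rewrite inE => /imsetP[S]; exists S. Qed.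

(** Exposing [U] as well gains [q ^+ #|U|] and drops [#|U|] factors [1 - q], each at most 1. *)
Lemma bmass_shift q D W U : 0 <= q <= 1 -> U \subset D :\: W ->
  bmass q D W * q ^+ #|U| <= bmass q D (W :|: U).
Proof.
move=> /andP[q0 q1]; rewrite subsetD => /andP[UD dUW].
rewrite /bmass cardsU.
have -> : W :&: U = set0 by apply/eqP; rewrite setI_eq0 disjoint_sym.
rewrite cards0 subn0 exprD mulrAC ler_wpM2l ?mulr_ge0 ?exprn_ge0 //.
apply: ler_wiXn2l; rewrite ?subr_ge0 ?gerBl //.
by apply: subset_leq_card; apply: setDS; apply: subsetUl.
Qed.

(* A fragment U of W is contained in every member of H inside W :|: U, so
   given the union Z there are at most as many candidates for U as subsets of
   one member of H. *)
Lemma expected_cost q c K D H l :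
  0 < q -> q <= 1 -> 0 <= c -> 0 <= K ->
  (forall S, S \in H -> S \subset D) ->
  (forall S, S \in H ->
     \sum_(U : {set X} | (U \subset S) && (l < #|U|)%N) (c / q) ^+ #|U| <= K) ->
  \sum_(W : {set X} | W \subset D) bmass q D W * cost c (large_fragments H W l)
    <= K.
Proof.
move=> q0 q1 c0 K0 HD HK.
have qq : 0 <= q <= 1 by rewrite ltW.
(* Write [c ^+ #|U|] as [q ^+ #|U| * (c / q) ^+ #|U|]; the first factor moves the mass from [W] to
   the union [W :|: U]. *)
pose g W U : R := if U \in large_fragments H W l
  then bmass q D (W :|: U) * (c / q) ^+ #|U| else 0.
apply: (@le_trans _ _ (\sum_(W : {set X} | W \subset D)
    \sum_(U : {set X} | U \subset D :\: W) g W U)).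
  apply: ler_sum => W WD; rewrite /cost mulr_sumr big_mkcond [leRHS]big_mkcond.
  apply: ler_sum => U _; rewrite /g.
  have [|_] := ifP; last by case: ifP.
  rewrite inE => /andP[/fragmentE[S SH ->] _].
  have SD : S :\: W \subset D :\: W by apply: setSD; apply: HD.
  rewrite SD expr_div_n mulrA ler_pdivlMr ?exprn_gt0 // mulrAC.
  by rewrite ler_wpM2r ?exprn_ge0 ?bmass_shift.
rewrite exchange_disjoint -[leRHS]mul1r -(bmass_sum q D) mulr_suml.
apply: ler_sum => Z ZD.
have [/existsP[S0 /andP[S0H S0Z]]|noS] := boolP (hit H Z); last first.
  rewrite big1 => [|U UZ]; first by apply: mulr_ge0 K0; apply: bmass_ge0.
  rewrite /g ifF //.
  apply: contraNF noS; rewrite inE => /andP[/fragmentE[S SH eU] _].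
  apply/existsP; exists S; rewrite SH /=.
  apply/subsetP => e eS; move/setP/(_ e): eU; rewrite !inE eS andbT.
  by move/subsetP/(_ e): UZ; case: (e \in U); case: (e \in Z) => //= ->.
apply: (@le_trans _ _ (bmass q D Z *
   \sum_(U : {set X} | (U \subset S0) && (l < #|U|)%N) (c / q) ^+ #|U|)); last first.
  by apply: ler_wpM2l; [exact: bmass_ge0|exact: HK].
rewrite mulr_sumr big_mkcond [leRHS]big_mkcond; apply: ler_sum => U _.
have nn : 0 <= bmass q D Z * (c / q) ^+ #|U|.
  by apply: mulr_ge0; [exact: bmass_ge0|rewrite exprn_ge0 // divr_ge0 // ltW].
have [UZ|] := boolP (U \subset Z); last by case: ifP.
rewrite /g; have [|_] := ifP; last by case: ifP.
rewrite inE => /andP[frU lU].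
have ZU : Z :\: U :|: U = Z.
  by rewrite setUC setDE setUIr setUCr setIT; apply/setUidPr.
rewrite ZU; suff -> : U \subset S0 by rewrite lU.
have [minU] := minsetP frU; move/(_ (S0 :\: (Z :\: U))) => <-.
- exact: subsetDl.
- exact: (imset_f (fun S => S :\: (Z :\: U)) S0H).
- apply/subsetP => e; rewrite !inE; move/subsetP/(_ e): S0Z.
  by case: (e \in S0); case: (e \in U); case: (e \in Z) => //= ->.
Qed.

(* The probability of hitting H is at least the cheapest cost of a cover of H,
   up to the error B. *)
Definition works (r c B : R) (l : nat) : Prop :=
  forall D H (a : R),
    (forall S, S \in H -> S \subset D /\ (#|S| <= l)%N) ->
    (forall C, covers C H -> a <= cost c C) ->
    a - B <= bprob r D (hit H).

(** If [set0] is in [H], every set hits and the cover [[set set0]] costs 1; otherwise [H] is empty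
    and its empty cover forces [a <= 0]. *)
Lemma works0 r c : works r c 0 0.
Proof.
move=> D H a HD Ha; rewrite subr0.
have H0 S : S \in H -> S = set0.
  by move=> /HD[_]; rewrite leqn0 cards_eq0 => /eqP.
have [h0|h0] := boolP (set0 \in H).
  apply: (@le_trans _ _ (cost c [set set0])).
    by apply: Ha => S /H0 ->; exists set0; rewrite ?inE.
  rewrite /cost big_set1 cards0 expr0 -(bmass_sum r D) le_eqVlt; apply/orP; left.
  apply/eqP/eq_bigr => W _; rewrite (_ : hit H W) ?mulr1 //.
  by apply/existsP; exists set0; rewrite h0 sub0set.
have HE S : S \in H = false by apply/negP => /[dup] /H0 -> ; apply/negP.
apply: (@le_trans _ _ (cost c set0)).
  by apply: Ha => S; rewrite HE.
rewrite /cost big_set0 /bprob big1 // => W _.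
by rewrite (_ : hit H W = false) ?mulr0 //; apply/existsP => -[S]; rewrite HE.
Qed.

(** After the first round [W], a cover of the small fragments together with the large fragments
    covers [H]. So covering the small ones costs at least [a] minus the cost of the large ones,
    which averages to at most [K]; hitting a small fragment completes a member of [H]. *)
Lemma works_step q r c B K l l' :
  0 < q -> q <= 1 -> 0 <= r <= 1 -> 0 <= c -> 0 <= K ->
  (forall S, (#|S| <= l)%N ->
     \sum_(U : {set X} | (U \subset S) && (l' < #|U|)%N) (c / q) ^+ #|U| <= K) ->
  works r c B l' -> works (q + (1 - q) * r) c (B + K) l.
Proof.
move=> q0 q1 r01 c0 K0 HK IH D H a HD Ha.
have qq : 0 <= q <= 1 by rewrite ltW.
rewrite bprob_split.
apply: (@le_trans _ _ (\sum_(W : {set X} | W \subset D)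
    bmass q D W * (a - cost c (large_fragments H W l') - B))).
  under eq_bigr do rewrite addrAC mulrBr.
  rewrite sumrB -mulr_suml bmass_sum mul1r opprD addrA lerB //.
  by apply: expected_cost => // S /HD[] // _; apply: HK.
apply: ler_sum => W WD; rewrite ler_wpM2l ?bmass_ge0 //.
apply: (@le_trans _ _ (bprob r (D :\: W) (hit (small_fragments H W l')))).
  apply: IH => [S|C CH].
    rewrite inE => /andP[/fragmentE[S' S'H ->] ->]; split => //.
    by apply: setSD; apply: (HD _ S'H).1.
  rewrite lerBlDr.
  apply: le_trans (Ha (C :|: large_fragments H W l') _) _ => [S SH|].
    have [U fU US] := fragments_cover W SH.
    have [sU|lU] := leqP #|U| l'.
      have [|U' U'C U'U] := CH U; first by rewrite inE fU.
      by exists U'; rewrite ?inE ?U'C // (subset_trans U'U).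
    by exists U; rewrite // !inE fU lU orbT.
  rewrite /cost [leLHS]big_mkcond [X in _ <= X + _]big_mkcond.
  rewrite [X in _ <= _ + X]big_mkcond.
  rewrite -big_split /=; apply: ler_sum => U _.
  have cU : 0 <= c ^+ #|U| by rewrite exprn_ge0.
  by rewrite in_setU; do 2 case: (_ \in _); rewrite /= ?addr0 ?add0r // lerDl.
apply: ler_sum => U _; rewrite ler_wpM2l ?bmass_ge0 //.
rewrite ler_nat; case: (boolP (hit _ U)) => // /existsP[T /andP[]].
rewrite inE => /andP[/fragmentE[S SH ->] _] SU.
rewrite (_ : hit H (W :|: U)) //; apply/existsP; exists S; rewrite SH /=.
apply/subsetP => e eS; rewrite inE; case: (boolP (e \in W)) => //= eW.
by apply: (subsetP SU); rewrite inE eS eW.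
Qed.

Lemma sum_nonempty_subsets S (b : R) :
  \sum_(U : {set X} | (U \subset S) && (0 < #|U|)%N) b ^+ #|U| =
  (1 + b) ^+ #|S| - 1.
Proof.
have := sum_subsets S b 1.
rewrite (bigD1 set0) ?sub0set //= cards0 expr0 mul1r expr1n addrC.
move=> /(canRL (addrK _)).
rewrite [b + 1]addrC => <-; apply: eq_big => [U|U _]; last by rewrite expr1n mulr1.
by rewrite card_gt0.
Qed.

Lemma sum_large_subsets S (b : R) l : 0 <= b <= 1 ->
  \sum_(U : {set X} | (U \subset S) && (l < #|U|)%N) b ^+ #|U| <=
  2 ^+ #|S| * b ^+ l.
Proof.
move=> /andP[b0 b1].
apply: (@le_trans _ _ (\sum_(U in powerset S) b ^+ l)); last first.
  by rewrite sumr_const card_powerset -natrX mulr_natl.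
rewrite big_mkcond [leRHS]big_mkcond; apply: ler_sum => U _.
rewrite powersetE; case: (U \subset S) => //=; case: ifP => [lU|_].
  by rewrite ler_wiXn2l // ltnW.
exact: exprn_ge0.
Qed.

(* Each of j rounds at density 6c halves the fragments; a last round removes
   those of size at most w. *)
Lemma works_rounds (c t p : R) (w j : nat) : 0 < c -> 0 < t -> (0 < w)%N ->
  j%:R * (6 * c) + t <= p -> p <= 1 ->
  works p c ((1 + c / t) ^+ w - 1 + \sum_(i < j) (2 / 3) ^+ (w * 2 ^ i))
    (w * 2 ^ j).
Proof.
move=> c0 t0 w0; elim: j p => [|j IH] p.
  rewrite mul0r add0r big_ord0 muln1 => tp p1.
  have p0 : 0 < p by apply: lt_le_trans t0 tp.
  (* Read [p] as one round of density [p] followed by a void round of density 0, so that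
     [works_step] applies on top of [works0]. *)
  rewrite -[X in works X](addr0) -[X in _ + X](mulr0 (1 - p)).
  rewrite [X in works _ _ X](addrC _ 0).
  have ct : 0 <= c / t by rewrite divr_ge0 ?ltW.
  apply: (works_step (l' := 0%N)) => //.
  - by rewrite lexx ler01.
  - exact: ltW.
  - by rewrite subr_ge0 exprn_ege1 // lerDl.
  - move=> S Sw; rewrite sum_nonempty_subsets lerB //.
    apply: (@le_trans _ _ ((1 + c / t) ^+ #|S|)); last first.
      by apply: ler_weXn2l => //; rewrite lerDl.
    have cp : 0 <= c / p by rewrite divr_ge0 ?ltW.
    apply: lerXn2r; rewrite ?nnegrE ?addr_ge0 //.
    by rewrite lerD2l ler_pM2l // lef_pV2.
  - exact: works0.
rewrite -natr1 mulrDl mul1r => jp p1.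
have q0 : 0 < 6 * c by rewrite mulr_gt0.
have j0 : 0 <= j%:R * (6 * c) by rewrite mulr_ge0 // ltW.
have qp : 6 * c < p by lra.
have q1 : 6 * c < 1 by apply: lt_le_trans qp p1.
(* The conditional density left after a round of density [6 * c]; it is at least [p - 6 * c], enough
   for the remaining rounds. *)
pose r := (p - 6 * c) / (1 - 6 * c).
have Dq : 0 < 1 - 6 * c by lra.
have -> : p = 6 * c + (1 - 6 * c) * r.
  by rewrite /r mulrCA divff ?gt_eqF // mulr1 addrC subrK.
have r0 : p - 6 * c <= r by rewrite /r ler_pdivlMr // ler_piMr; lra.
have r1 : r <= 1 by rewrite /r ler_pdivrMr //; lra.
rewrite big_ord_recr /= addrA.
apply: (@works_step _ _ _ _ _ _ (w * 2 ^ j)) => //; try exact: ltW.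
- by apply/andP; split => //; lra.
- by rewrite exprn_ge0 //; lra.
- move=> S Sw.
  (* With [m = w * 2 ^ j], a set of size at most [2m] has at most [4^m] subsets, and those larger
     than [m] weigh at most [6^-m] each: in all [(4/6)^m]. *)
  have -> : c / (6 * c) = 6^-1 by field; lra.
  apply: le_trans (sum_large_subsets _ _ _) _; first lra.
  apply: (@le_trans _ _ (2 ^+ (2 * (w * 2 ^ j)) * 6^-1 ^+ (w * 2 ^ j))).
    rewrite ler_wpM2r ?exprn_ge0 ?invr_ge0 // ler_weXn2l ?ler1n //.
    by rewrite mulnCA -expnS.
  rewrite exprM -exprMn (_ : 2 ^+ 2 * 6^-1 = 2 / 3 :> R) //.
  by rewrite expr2; lra.
- by apply: IH => //; lra.
Qed.

End Rounds.

Local Open Scope nat_scope.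

(** * Counting embeddings of forests *)

(** An integer substitute for [(1 + 1/N)^k <= e]: it reads [(1 + 1/N)^k <= 1 + k/N + (k/N)^2], whose
    three terms are at most 1 each and give the constant 3 below. *)
Lemma expnS_le_quad (N k : nat) : k <= N ->
  N ^ 2 * N.+1 ^ k <= N ^ k * (N ^ 2 + k * N + k ^ 2).
Proof.
elim: k => [|k IH] kN; first by rewrite !expn0 muln1 mul1n -addnA leq_addr.
have {}IH := IH (ltnW kN).
have -> : N ^ 2 * N.+1 ^ k.+1 = N.+1 * (N ^ 2 * N.+1 ^ k).
  by rewrite [N.+1 ^ _]expnS mulnCA.
apply: leq_trans (leq_mul (leqnn N.+1) IH) _.
have -> : N ^ k.+1 * (N ^ 2 + k.+1 * N + k.+1 ^ 2)
        = N ^ k * (N * (N ^ 2 + k.+1 * N + k.+1 ^ 2)).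
  by rewrite [N ^ k.+1]expnS -mulnA mulnCA.
rewrite mulnCA leq_mul2l; apply/orP; right.
have : k * k <= k * N by rewrite leq_mul2l ltnW ?orbT.
by rewrite -!mulnn; nia.
Qed.

Lemma expnS_le3 (N k : nat) : k <= N -> N.+1 ^ k <= 3 * N ^ k.
Proof.
case: N => [|N] kN; first by move: kN; rewrite leqn0 => /eqP ->.
have N2 : 0 < N.+1 ^ 2 by rewrite expn_gt0.
rewrite -(leq_pmul2l N2); apply: leq_trans (expnS_le_quad kN) _.
rewrite mulnA [leqRHS]mulnC leq_mul2l; apply/orP; right.
by rewrite -!mulnn; nia.
Qed.

(** With [n = m + k], the falling factorial [n! / (n - k)!] is at least [(n / 3)^k]: replacing maps
    by injections loses a factor 3 per fixed vertex. *)
Lemma expn_fact_le (m k : nat) : (m + k) ^ k * m`! <= 3 ^ k * (m + k)`!.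
Proof.
elim: k => [|k IH]; first by rewrite addn0.
have H := @expnS_le3 (m + k) k (leq_addl _ _).
rewrite addnS factS [_ ^ k.+1]expnS [3 ^ _]expnS -mulnA [leqRHS]mulnCA -mulnA.
rewrite leq_mul2l; apply/orP; right.
apply: leq_trans (leq_mul H (leqnn _)) _.
by rewrite -mulnA leq_mul2l IH orbT.
Qed.

(** * Forests as bare edge sets, and leaf induction *)

Section Forests.

Variable W : finType.
Implicit Types (E : {set {set W}}) (x y : W).

Definition edge_rel E : rel W := fun x y => [set x; y] \in E.

Definition acyclic_edges E : Prop :=
  forall c : seq W, 2 < size c -> ~ ucycle (edge_rel E) c.

Lemma acyclic_edgesS E E' : E' \subset E -> acyclic_edges E -> acyclic_edges E'.
Proof.
move=> sE acE c c2 /andP[cyc uc]; apply: (acE c c2); rewrite /ucycle uc andbT.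
by apply: sub_cycle cyc => x y; apply: (subsetP sE).
Qed.

Lemma edge_relC E : symmetric (edge_rel E).
Proof. by move=> x y; rewrite /edge_rel setUC. Qed.

Lemma pairP (e : {set W}) x : e \in pairs W -> x \in e ->
  exists2 y, y != x & e = [set x; y].
Proof.
rewrite inE => /cards2P[a [b [ab ->]]]; rewrite !inE => /orP[]/eqP->.
  by exists b; rewrite // eq_sym.
by exists a; rewrite // setUC.
Qed.

(* The end point of a longest path. *)
Lemma forest_leaf E : E \subset pairs W -> acyclic_edges E -> E != set0 ->
  exists x y, [/\ x != y, [set x; y] \in E &
    forall e, e \in E -> x \in e -> e = [set x; y]].
Proof.
move=> EP acE /set0Pn[e0 e0E].
pose P m := [exists s : m.-tuple W, uniq s && sorted (edge_rel E) s].
have P2 : P 2.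
  have := subsetP EP _ e0E; rewrite inE => /cards2P[a [b [ab e0ab]]].
  by apply/existsP; exists [tuple a; b]; rewrite /= inE ab /edge_rel -e0ab e0E.
have Pb m : P m -> m <= #|W|.
  case/existsP => s /andP[/card_uniqP us _].
  by rewrite -(size_tuple s) -us max_card.
have [m Pm maxm] := ex_maxnP (ex_intro _ 2 P2) Pb.
have m2 : 2 <= m := maxm _ P2.
case/existsP: Pm => s /andP[us ss]; have sz := size_tuple s.
case: {s}(val s) us ss sz => [|x [|y s]] us ss sz; try by rewrite -sz in m2.
have [xy ss'] : edge_rel E x y /\ path (edge_rel E) y s by apply/andP.
have nexy : x != y by move: us => /= /andP[]; rewrite inE negb_or => /andP[].
exists x, y; split => // e eE xe.
have [z zx eE'] := pairP (subsetP EP _ eE) xe; rewrite eE'.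
have xz : edge_rel E x z by rewrite /edge_rel -eE'.
(* A neighbour [z] of [x] off the path would prolong it, and one beyond [y] would close a cycle with
   at least three vertices. *)
have [|zs] := boolP (z \in x :: y :: s); last first.
  have: P m.+1.
    have szz : size [:: z, x, y & s] == m.+1 by rewrite /= -sz.
    apply/existsP; exists (Tuple szz); apply/andP; split.
      by apply/andP; split.
    by rewrite /= edge_relC xz xy ss'.
  by move/maxm; rewrite ltnn.
rewrite !inE (negPf zx) /= => /orP[/eqP->//|zs].
exfalso; case/splitPr: zs us ss' {sz ss} => s1 s2 us ss'.
apply: (acE (x :: y :: rcons s1 z)); first by rewrite /= size_rcons.
apply/andP; split.
  rewrite /= xy rcons_path /= last_rcons edge_relC xz andbT.
  by move: ss'; rewrite -cat_rcons cat_path => /andP[].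
by move: us; rewrite -cat_rcons -!cat_cons cat_uniq => /andP[].
Qed.

(** Repeatedly strip the leaf edge from [forest_leaf]. Only [x] is known to be new; [y] may be
    covered already or not. *)
Lemma forest_ind (P : {set {set W}} -> Prop) :
  P set0 ->
  (forall E x y, x != y -> x \notin cover E -> P E -> P ([set x; y] |: E)) ->
  forall E, E \subset pairs W -> acyclic_edges E -> P E.
Proof.
move=> P0 PS E; have [m] := ubnP #|E|; elim: m E => // m IH E Em EP acE.
have [->//|En] := eqVneq E set0.
have [x [y [xy xyE xleaf]]] := forest_leaf EP acE En.
rewrite -(setD1K xyE); apply: PS => //.
  apply/bigcupP => -[e]; rewrite !inE => /andP[ne eE] xe.
  by rewrite (xleaf e) ?eqxx in ne.
apply: IH; rewrite ?(subset_trans (subD1set _ _)) //.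
  by move: Em; rewrite (cardsD1 [set x; y]) xyE.
exact: acyclic_edgesS (subD1set _ _) acE.
Qed.

Lemma notin_cover E x y : x \notin cover E -> [set x; y] \notin E.
Proof.
apply: contra => xyE; apply/bigcupP; exists [set x; y] => //.
by rewrite !inE eqxx.
Qed.

Lemma coverU1 (A : {set W}) E : cover (A |: E) = A :|: cover E.
Proof. by rewrite /cover bigcup_setU big_set1. Qed.

Lemma forest_card E : E \subset pairs W -> acyclic_edges E -> #|E| <= #|cover E|.
Proof.
move: E; apply: forest_ind => [|E x y xy xE IH]; first by rewrite cards0.
rewrite cardsU1 (notin_cover y xE) coverU1.
have : x |: cover E \subset [set x; y] :|: cover E.
  by apply/setSU; rewrite sub1set !inE eqxx.
by move/subset_leq_card; apply: leq_trans; rewrite cardsU1 xE leq_add2l.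
Qed.

Lemma card_adj_pairs E : #|[set z : W * W | edge_rel E z.1 z.2]| <= 2 * #|E|.
Proof.
rewrite -sum1_card (partition_big (fun z : W * W => [set z.1; z.2]) (mem E)) /=;
  last by move=> z; rewrite inE.
rewrite mulnC -sum_nat_const; apply: leq_sum => e eE.
rewrite sum1dep_card.
have [->|[[a b] /=]] := set_0Vmem [set z : W * W | (z \in
    [set z0 | edge_rel E z0.1 z0.2]) && ([set z.1; z.2] == e)].
  by rewrite cards0.
rewrite !inE => /andP[_ /eqP abe].
apply: (@leq_trans #|[set (a, b); (b, a)]|); last by rewrite cards2; case: (_ == _).
apply: subset_leq_card; apply/subsetP => -[c d]; rewrite !inE /= -abe.
move=> /andP[_ /eqP/setP cd]; rewrite !xpair_eqE.
have := cd a; have := cd b; have := cd c; have := cd d; rewrite !inE !eqxx ?orbT /=.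
rewrite (eq_sym a c) (eq_sym a d) (eq_sym b c) (eq_sym b d).
by case: (c == a); case: (d == b); case: (c == b); case: (d == a).
Qed.

End Forests.

(** * Spread of a uniformly random bijection onto the vertices of the tree *)

Section Spread.

Variables (V W : finType) (E : {set {set V}}) (n D : nat).
Hypothesis cardV : #|V| = n.
Hypothesis cardW : #|W| = n.
Hypothesis cardE : #|E| <= n.
Hypothesis degE : forall v, #|[set u | edge_rel E v u]| <= D.
Hypothesis D6 : 6 <= D.
Implicit Types (U : {set {set W}}) (g : {ffun W -> V}).

(** Graph homomorphisms from [U] to [E], defined on all of [W], so that values outside [cover U] are
    free. *)
Definition homs U : {set {ffun W -> V}} :=
  [set g : {ffun W -> V} | [forall e in U, g @: (e : {set W}) \in E]].

Definition upd g x (a : V) : {ffun W -> V} :=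
  [ffun w => if w == x then a else g w].

Lemma imset_pair g x y : g @: [set x; y] = [set g x; g y].
Proof. by rewrite imsetU !imset_set1. Qed.

Lemma homsU1 U x y g : g \in homs ([set x; y] |: U) ->
  edge_rel E (g x) (g y) /\ g \in homs U.
Proof.
rewrite !inE => /forall_inP gU; split.
  by rewrite /edge_rel -imset_pair gU // !inE eqxx.
by apply/forall_inP => e eU; rewrite gU // inE eU orbT.
Qed.

Lemma upd_homs U x g a : x \notin cover U -> g \in homs U -> upd g x a \in homs U.
Proof.
move=> xU; rewrite !inE => /forall_inP gU; apply/forall_inP => e eU.
rewrite (_ : _ @: e = g @: e) ?gU //; apply: eq_in_imset => w we.
rewrite ffunE; case: eqP => // wx; case/negP: xU.
by apply/bigcupP; exists e; rewrite -?wx.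
Qed.

Lemma upd_inj g g' x a a' : upd g x a = upd g' x a' -> g x = g' x -> g = g' /\ a = a'.
Proof.
move=> /ffunP H gx; split.
  by apply/ffunP => w; have := H w; rewrite !ffunE; case: eqP => // ->.
by have := H x; rewrite !ffunE eqxx.
Qed.

(** Overwrite [g x] by an arbitrary [a] and remember the old value. This is injective and keeps a
    homomorphism of [U]; the old value is one of at most [D] neighbours of [g y]. *)
Lemma homs_leaf U x y : x != y -> x \notin cover U ->
  #|homs ([set x; y] |: U)| * n <= #|homs U| * D.
Proof.
move=> xy xU.
pose A := setX (homs ([set x; y] |: U)) [set: V].
pose B := [set z : {ffun W -> V} * V | (z.1 \in homs U) && edge_rel E (z.1 y) z.2].
pose F (z : {ffun W -> V} * V) := (upd z.1 x z.2, z.1 x).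
have -> : #|homs ([set x; y] |: U)| * n = #|A| by rewrite cardsX cardsT cardV.
have injF : injective F.
  by move=> [g a] [g' a'] [/upd_inj H /H[/= -> ->]].
have sFB : F @: A \subset B.
  apply/subsetP => _ /imsetP[[g a]] /setXP[/homsU1[gxy gU] _] ->.
  rewrite inE /= upd_homs // ffunE eq_sym (negPf xy).
  by rewrite edge_relC.
rewrite -(card_imset _ injF); apply: leq_trans (subset_leq_card sFB) _.
rewrite -sum1_card (partition_big fst (mem (homs U))) /=; last first.
  by move=> z; rewrite inE => /andP[].
rewrite -sum_nat_const; apply: leq_sum => g gU.
apply: leq_trans (degE (g y)); rewrite sum1dep_card.
rewrite -(card_imset [set u | edge_rel E (g y) u] (f := fun u => (g, u))); last first.
  by move=> u v [].
apply: subset_leq_card; apply/subsetP => -[g' u]; rewrite !inE /=.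
move=> /andP[/andP[_ gu] /eqP eg]; rewrite eg in gu *.
by apply/imsetP; exists u; rewrite ?inE.
Qed.

(* An isolated edge has at most 2 #|E| images instead of n ^ 2; this gain pays
   for the two new vertices in homs_bound as soon as 3 ^ 2 * 2 <= 3 * D. *)
Lemma homs_isolated U x y : x != y -> x \notin cover U -> y \notin cover U ->
  #|homs ([set x; y] |: U)| * n <= #|homs U| * 2.
Proof.
move=> xy xU yU.
have [n0|n0] := posnP n; first by rewrite n0 muln0.
rewrite -(leq_pmul2r n0) -!mulnA.
pose A := setX (homs ([set x; y] |: U)) [set: V * V].
pose B := setX (homs U) [set z : V * V | edge_rel E z.1 z.2].
(* The same exchange at both ends: the two remembered values form an ordered edge of [E], and there
   are at most [2 * n] of these. *)
pose F (z : {ffun W -> V} * (V * V)) :=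
  (upd (upd z.1 x z.2.1) y z.2.2, (z.1 x, z.1 y)).
have -> : #|homs ([set x; y] |: U)| * (n * n) = #|A|.
  by rewrite cardsX cardsT card_prod cardV.
have injF : injective F.
  move=> [g [a b]] [g' [a' b']] [/upd_inj H gx gy]; have := H _.
  rewrite !ffunE eq_sym (negPf xy) => /(_ gy)[/upd_inj /= /(_ gx) [-> ->] ->] //.
have sFB : F @: A \subset B.
  apply/subsetP => _ /imsetP[[g ab]] /setXP[/homsU1[gxy gU] _] ->.
  apply/setXP; split; last by rewrite inE.
  exact: upd_homs yU (upd_homs ab.1 xU gU).
rewrite -(card_imset _ injF); apply: leq_trans (subset_leq_card sFB) _.
rewrite cardsX leq_mul2l; apply/orP; right.
by apply: leq_trans (card_adj_pairs E) _; rewrite leq_mul2l.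
Qed.

(** The power of 3 prepays the loss per covered vertex in passing to injections. A leaf edge costs
    [3 * D], an isolated one [3 ^ 2 * 2 = 18], which is at most [3 * D]. *)
Lemma homs_bound U : U \subset pairs W -> acyclic_edges U ->
  #|homs U| * 3 ^ #|cover U| * n ^ #|U| <= n ^ n * (3 * D) ^ #|U|.
Proof.
move: U; apply: forest_ind => [|U x y xy xU IH].
  rewrite /cover big_set0 !cards0 !muln1; apply: leq_trans (max_card _) _.
  by rewrite card_ffun cardV cardW.
rewrite cardsU1 (notin_cover y xU) coverU1 !expnS -setUA cardsU1.
have [yU|yU] := boolP (y \in cover U).
  have -> : y |: cover U = cover U by apply/setUidPr; rewrite sub1set.
  rewrite xU expnD expn1.
  have := homs_leaf xy xU; set h := #|homs _|; set h' := #|homs _| in IH *.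
  move: IH; set v := 3 ^ _; set s := n ^ #|U|; set N := n ^ n; set d := (_ ^ #|U|).
  move=> IH hh'.
  have -> : h * (3 * v) * (n * s) = 3 * (h * n) * (v * s) by lia.
  apply: (@leq_trans (3 * (h' * D) * (v * s)));
    first by rewrite leq_mul2r leq_mul2l hh' !orbT.
  have -> : 3 * (h' * D) * (v * s) = (h' * v * s) * (3 * D) by lia.
  by rewrite [leqRHS](_ : _ = N * d * (3 * D)) ?leq_mul2r ?IH ?orbT //; lia.
rewrite inE negb_or inE xy xU cardsU1 yU !expnD !expn1.
have := homs_isolated xy xU yU; set h := #|homs _|; set h' := #|homs _| in IH *.
move: IH; set v := 3 ^ _; set s := n ^ #|U|; set N := n ^ n; set d := (_ ^ #|U|).
move=> IH hh'.
have -> : h * (3 * (3 * v)) * (n * s) = 9 * (h * n) * (v * s) by lia.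
apply: (@leq_trans (9 * (h' * 2) * (v * s)));
  first by rewrite leq_mul2r leq_mul2l hh' !orbT.
have -> : 9 * (h' * 2) * (v * s) = (h' * v * s) * 18 by lia.
rewrite [leqRHS](_ : _ = N * d * (3 * D)); last by lia.
by apply: leq_mul => //; lia.
Qed.

Definition inj_homs U : {set {ffun W -> V}} := [set g in homs U | injectiveb g].

(* Grouping maps by their values on the vertices of U, each class contains
   n ^ (n - v) maps but at most (n - v)! injections. *)
Lemma inj_homs_le U :
  #|inj_homs U| * n ^ (n - #|cover U|) <= #|homs U| * (n - #|cover U|)`!.
Proof.
set C := cover U.
pose T := {w | w \in ~: C}.
have cardT : #|{: T}| = n - #|C|.
  by rewrite -cardW -(cardsC C) addKn card_sig; apply: eq_card => w; rewrite !inE.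
pose rho g : {ffun {w | w \in C} -> V} := [ffun w => g (val w)].
pose glue (g : {ffun W -> V}) (h : {ffun T -> V}) : {ffun W -> V} :=
  [ffun w => if insub w is Some w' then h w' else g w].
have rhoP g g' w : rho g = rho g' -> w \in C -> g w = g' w.
  by move=> /ffunP H wC; have := H (Sub w wC); rewrite !ffunE.
have TC (w : W) (wC : w \in ~: C) : insub w = Some (Sub w wC : T).
  exact: insubT.
have glueC g h w : w \in C -> glue g h w = g w.
  by move=> wC; rewrite ffunE insubF // inE wC.
have rho_glue g h : rho (glue g h) = rho g.
  by apply/ffunP => w; rewrite !ffunE insubF // inE (valP w).
(* The classes that contain an injection: [inj_le] bounds the injections in each, [homs_ge] counts
   all extensions of each by [glue]. *)
pose I := rho @: inj_homs U.
have inj_le : #|inj_homs U| <= #|I| * (n - #|C|)`!.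
  rewrite -sum1_card (partition_big rho (mem I)) /=; last by move=> g; apply: imset_f.
  rewrite -sum_nat_const; apply: leq_sum => _ /imsetP[g0 g0U ->].
  rewrite sum1dep_card.
  pose Q := [set a | a \notin g0 @: C].
  have g0i : injective g0 by move: g0U; rewrite inE => /andP[_ /injectiveP].
  have cardQ : #|Q| = n - #|C|.
    have -> : Q = ~: (g0 @: C) by apply/setP => a; rewrite !inE.
    by rewrite cardsCs setCK cardV card_imset.
  rewrite -ffactnn -{1}cardQ -cardT -card_inj_ffuns_on.
  pose sigma g : {ffun T -> V} := [ffun w => g (val w)].
  rewrite -(card_in_imset (f := sigma)); last first.
    move=> g g'; rewrite !inE => /andP[_ /eqP rg] /andP[_ /eqP rg'] /ffunP sg.
    apply/ffunP => w; have [wC|wC] := boolP (w \in C).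
      by apply: rhoP wC; rewrite rg.
    have wT : w \in ~: C by rewrite inE.
    by have := sg (Sub w wT); rewrite !ffunE.
  apply: subset_leq_card; apply/subsetP => _ /imsetP[g gin ->].
  move: gin; rewrite !inE => /andP[/andP[_ /injectiveP gi] /eqP rg].
  apply/andP; split; last first.
    by apply/injectiveP => w w'; rewrite !ffunE => /gi/val_inj.
  apply/ffun_onP => w; rewrite ffunE inE; apply/imsetP => -[w' w'C].
  rewrite -(rhoP g g0 w' rg w'C) => /gi ww'.
  by have := valP w; rewrite /= ww' inE w'C.
have homs_ge : #|I| * n ^ (n - #|C|) <= #|homs U|.
  rewrite -[leqRHS]sum1_card.
  apply: (@leq_trans (\sum_(g in homs U | rho g \in I) 1)); last first.
    by rewrite [leqRHS](bigID (fun g => rho g \in I)) /= leq_addr.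
  rewrite (partition_big rho (mem I)) /=; last by move=> g /andP[].
  rewrite -sum_nat_const; apply: leq_sum => _ /imsetP[g0 g0U ->].
  rewrite sum1dep_card -cardT -cardV -card_ffun.
  rewrite -(card_imset _ (f := glue g0)); last first.
    move=> h h' /ffunP hh'; apply/ffunP => w; have := hh' (val w).
    by rewrite !ffunE !valK.
  apply: subset_leq_card; apply/subsetP => _ /imsetP[h _ ->].
  rewrite !inE rho_glue eqxx imset_f // !andbT.
  apply/forall_inP => e eU.
  rewrite (_ : _ @: e = g0 @: e).
    by move: g0U; rewrite !inE => /andP[/forall_inP/(_ e eU)].
  by apply: eq_in_imset => w we; apply: glueC; apply/bigcupP; exists e.
apply: leq_trans (leq_mul inj_le (leqnn _)) _.
by rewrite mulnAC leq_mul2r homs_ge orbT.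
Qed.

(* The uniform measure on copies is (3 D / n)-spread. *)
Lemma inj_homs_spread U : U \subset pairs W -> acyclic_edges U ->
  #|inj_homs U| * n ^ #|U| <= n`! * (3 * D) ^ #|U|.
Proof.
move=> UP acU.
have [n0|n0] := posnP n.
  have E0 : E = set0.
    by apply/eqP; rewrite -cards_eq0 -leqn0 -[X in _ <= X]n0.
  have U0 : U = set0.
    apply/eqP; rewrite -cards_eq0 -leqn0 (leq_trans (forest_card UP acU)) //.
    by rewrite (leq_trans (max_card _)) // cardW n0.
  rewrite U0 cards0 !muln1 n0 (leq_trans (max_card _)) //.
  by rewrite card_ffun cardW n0.
have vn : #|cover U| <= n by rewrite -cardW max_card.
have := expn_fact_le (n - #|cover U|) #|cover U|; rewrite subnK //.
have := homs_bound UP acU; have := inj_homs_le U.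
have -> : n ^ n = n ^ (n - #|cover U|) * n ^ #|cover U| by rewrite -expnD subnK.
have : 0 < n ^ (n - #|cover U|) by rewrite expn_gt0 n0.
have : 0 < 3 ^ #|cover U| by rewrite expn_gt0.
set v := #|cover U|; set a := #|inj_homs U|; set b := n ^ (n - v); set h := #|homs U|.
set f := (n - v)`!; set t := 3 ^ v; set s := n ^ #|U|; set c := n ^ v.
set d := (3 * D) ^ #|U|; set F := n`!.
move=> t0 b0 H1 H2 H3.
(* Once the denominators are cleared, chain [inj_homs_le], [homs_bound] and [expn_fact_le]. *)
rewrite -(leq_pmul2l t0) -(leq_pmul2l b0).
apply: (@leq_trans (h * f * (t * s))).
  by rewrite (_ : b * _ = a * b * (t * s)) ?leq_mul2r ?H1 ?orbT //; lia.
apply: (@leq_trans (b * c * d * f)).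
  by rewrite (_ : h * f * _ = h * t * s * f) ?leq_mul2r ?H2 ?orbT //; lia.
rewrite (_ : b * c * d * f = (b * d) * (c * f)); last by lia.
rewrite [leqRHS](_ : _ = (b * d) * (t * F)); last by lia.
by rewrite leq_mul2l H3 orbT.
Qed.

End Spread.

Local Open Scope ring_scope.

(** * Copies of a tree in the random graph *)

Section Copies.

Variables (R : realType) (V W : finType) (T : sgraph V) (n D : nat).
Hypothesis cardV : #|V| = n.
Hypothesis cardW : #|W| = n.
Hypothesis acT : acyclic T.
Hypothesis degT : (max_degree T <= D)%N.
Hypothesis D6 : (6 <= D)%N.

(** The placement is encoded by its inverse [g], so that a set of pairs lies in the copy exactly
    when [g] is a homomorphism on it. *)
Definition copy (g : {ffun W -> V}) : {set {set W}} :=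
  [set e in pairs W | g @: (e : {set W}) \in edges T].

Definition copies : {set {set {set W}}} :=
  copy @: [set g : {ffun W -> V} | injectiveb g].

Lemma acyclic_copy (g : {ffun W -> V}) : injective g -> acyclic_edges (copy g).
Proof.
move=> gi c c2 /andP[cyc uc].
apply: (acT (c := map g c)); first by rewrite size_map.
rewrite /ucycle map_inj_uniq // uc andbT.
apply: homo_cycle cyc => x y.
by rewrite /edge_rel inE /adj imsetU !imset_set1 => /andP[].
Qed.

Lemma copyS_pairs (g : {ffun W -> V}) : copy g \subset pairs W.
Proof. by apply/subsetP => e; rewrite inE => /andP[]. Qed.

Lemma card_copy (g : {ffun W -> V}) : injective g -> (#|copy g| <= n)%N.
Proof.
move=> gi; rewrite (leq_trans (forest_card (copyS_pairs g) (acyclic_copy gi))) //.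
by rewrite -cardW max_card.
Qed.

(** Union bound: the copy of each of the [n!] injections contains some [U] in [C], and the spread
    bounds how many copies contain a given [U]. *)
Lemma copies_spread C : (0 < n)%N -> covers C copies ->
  1 <= cost ((3 * D)%:R / n%:R : R) C.
Proof.
move=> n0 Ccov; have nR : 0 < n%:R :> R by rewrite ltr0n.
have facR : 0 < (n`!)%:R :> R by rewrite ltr0n fact_gt0.
rewrite -(ler_pM2l facR) mulr1 /cost mulr_sumr.
apply: (@le_trans _ _ (\sum_(U in C)
   (#|[set g : {ffun W -> V} | injectiveb g && (U \subset copy g)]|)%:R)).
  rewrite -natr_sum ler_nat -ffactnn -{1}cardV -cardW -card_inj_ffuns.
  rewrite -sum1_card.
  under [leqRHS]eq_bigr do rewrite -sum1dep_card big_mkcond /=.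
  rewrite exchange_big /= big_mkcond; apply: leq_sum => g _; rewrite inE.
  case: ifP => // gi.
  have [|U UC Ug] := Ccov (copy g); first by apply/imsetP; exists g; rewrite ?inE.
  by rewrite (bigD1 U) //= Ug.
apply: ler_sum => U _.
have nn : 0 <= n`!%:R * ((3 * D)%:R / n%:R) ^+ #|U| :> R.
  by rewrite mulr_ge0 ?ler0n // exprn_ge0 // divr_ge0.
(* A [U] inside no copy contributes 0; any other inherits acyclicity from a copy, as the spread
   bound requires. *)
set A := [set g | _]; have [->|[g0]] := set_0Vmem A; first by rewrite cards0.
rewrite inE => /andP[/injectiveP gi Ug].
have UP := subset_trans Ug (copyS_pairs g0).
have acU := acyclic_edgesS Ug (acyclic_copy gi).
have acE : acyclic_edges (edges T) by move=> c; apply: acT.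
have cardE : (#|edges T| <= n)%N.
  by rewrite (leq_trans (forest_card (edges_pairs T) acE)) // -cardV max_card.
have degE v : (#|[set u | edge_rel (edges T) v u]| <= D)%N.
  apply: leq_trans degT; rewrite /max_degree.
  exact: (leq_bigmax (F := degree T)).
have := inj_homs_spread cardV cardW cardE degE D6 UP acU.
rewrite expr_div_n mulrA ler_pdivlMr ?exprn_gt0 // -!natrX -!natrM ler_nat.
apply: leq_trans; rewrite leq_mul2r subset_leq_card ?orbT //.
apply/subsetP => g; rewrite !inE => /andP[-> /subsetP Ug']; rewrite andbT.
by apply/forall_inP => e /Ug'; rewrite inE => /andP[].
Qed.

Lemma hit_copy (G : sgraph W) : hit copies (edges G) -> contains_copy T G.
Proof.
case/existsP => S /andP[/imsetP[g]]; rewrite inE => /injectiveP gi -> gG.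
have [f fK gK] : bijective g by apply: inj_card_bij; rewrite ?cardV ?cardW.
apply/existsP; exists [ffun v => f v]; apply/andP; split.
  by apply/injectiveP => u v; rewrite !ffunE => /(can_inj gK).
apply/subsetP => _ /imsetP[e eE ->]; apply: (subsetP gG).
have -> : [ffun v => f v] @: e = f @: e by apply: eq_imset => v; rewrite ffunE.
rewrite !inE card_imset; last exact: can_inj gK.
have -> : g @: (f @: e) = e.
  by rewrite -imset_comp -[RHS]imset_id; apply: eq_imset => v /=; rewrite gK.
by rewrite eE andbT; have := subsetP (edges_pairs T) _ eE; rewrite inE.
Qed.

End Copies.

Lemma gnp_probE (R : realType) n (p : R) (A : pred (sgraph 'I_n))
    (P : pred {set {set 'I_n}}) :
  0 <= p <= 1 -> (forall G, P (edges G) -> A G) ->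
  bprob p (pairs 'I_n) P <= gnp_prob p A.
Proof.
move=> p01 PA.
rewrite /bprob (reindex_omap (@edges 'I_n) insub) /=; last first.
  by move=> J JD; rewrite insubT.
rewrite /gnp_prob [leRHS]big_mkcond.
under eq_bigl => G do rewrite valK eqxx edges_pairs.
apply: ler_sum => G _.
have -> : gnp_mass p G = bmass p (pairs 'I_n) (edges G).
  rewrite /gnp_mass /bmass (bigID (fun e => e \in edges G)) /=; congr (_ * _).
    rewrite -prodr_const; apply: eq_big => e; last by move=> /andP[_ ->].
    by apply/andP/idP => [[]//|eG]; split => //; apply: (subsetP (edges_pairs G)).
  rewrite -prodr_const; apply: eq_big => e; last by move=> /andP[_ /negPf ->].
  by rewrite in_setD andbC.
have := bmass_ge0 (pairs 'I_n) (edges G) p01.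
have := PA G; case: (P _) => [/(_ isT) ->|_]; first by rewrite mulr1.
by rewrite mulr0; case: ifP.
Qed.

(** This is [works_rounds] with [c = 3 * D / n] and [a = 1], the latter supplied by [copies_spread];
    copies have at most [n] edges. *)
Lemma contains_copy_prob (R : realType) (V : finType) (T : sgraph V)
    (n D J w : nat) (t p : R) :
  #|V| = n -> acyclic T -> (max_degree T <= D)%N -> (6 <= D)%N ->
  (0 < n)%N -> (0 < w)%N -> (n <= w * 2 ^ J)%N -> 0 < t -> p <= 1 ->
  J%:R * (18 * D%:R / n%:R) + t <= p ->
  1 - ((1 + 3 * D%:R / n%:R / t) ^+ w - 1 + \sum_(i < J) (2 / 3) ^+ (w * 2 ^ i))
  <= gnp_prob p (fun G : sgraph 'I_n => contains_copy T G).
Proof.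
move=> cardV acT degT D6 n0 w0 nJ t0 p1 Jp.
have nR : 0 < n%:R :> R by rewrite ltr0n.
have DR : 0 < D%:R :> R by rewrite ltr0n; lia.
pose c : R := 3 * D%:R / n%:R.
have c0 : 0 < c by rewrite divr_gt0 // mulr_gt0.
have c6 : 6 * c = 18 * D%:R / n%:R by rewrite /c; ring.
have Jc : 0 <= J%:R * (6 * c) by rewrite mulr_ge0 // mulr_ge0 // ltW.
rewrite -c6 in Jp.
have cardW : #|'I_n| = n by rewrite card_ord.
have := works_rounds c0 t0 w0 Jp p1;
move/(_ {set 'I_n} (pairs 'I_n) (copies 'I_n T) 1).
move=> H; apply: le_trans (gnp_probE _ _); last first.
- by move=> G; apply: hit_copy cardV cardW _.
- by apply/andP; split => //; lra.
apply: H => [S|C Ccov].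
  case/imsetP => g; rewrite inE => /injectiveP gi ->; split; first exact: copyS_pairs.
  by apply: leq_trans (card_copy cardW acT gi) nJ.
by have := copies_spread R cardV cardW acT degT D6 n0 Ccov; rewrite natrM.
Qed.

(** * Numerical estimates *)

Section Numerics.

Variable R : realType.

(** Since [2 ^ i >= i + 1], a geometric series of ratio at most [2 / 3] dominates. *)
Lemma sum_tower_le (x : R) (J : nat) : 0 <= x -> x <= 2 / 3 ->
  \sum_(i < J) x ^+ (2 ^ i) <= 3 * x.
Proof.
move=> x0 x1; suff : \sum_(i < J) x ^+ (2 ^ i) <= 3 * x - 3 * x ^+ J.+1.
  by have := exprn_ge0 J.+1 x0; lra.
elim: J => [|J IH]; first by rewrite big_ord0 expr1 subrr.
rewrite big_ord_recr /=.
have H1 : x ^+ (2 ^ J) <= x ^+ J.+1.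
  by apply: ler_wiXn2l => //; [lra | rewrite ltn_expl].
have H2 : x ^+ J.+2 <= 2 / 3 * x ^+ J.+1.
  by rewrite exprS ler_wpM2r // exprn_ge0.
by lra.
Qed.

(** By convexity, [(1 + y) ^+ w] lies below its chord over the interval from 0 to 1. *)
Lemma expr1D_sub1_le (y : R) (w : nat) : 0 <= y <= 1 ->
  (1 + y) ^+ w - 1 <= 2 ^+ w * y.
Proof.
move=> /andP[y0 y1]; suff : (1 + y) ^+ w <= 1 + (2 ^+ w - 1) * y
  by rewrite mulrBl; lra.
elim: w => [|w IH]; first by rewrite !expr0; lra.
have w1 : 1 <= 2 ^+ w :> R by rewrite exprn_ege1 // ler1n.
rewrite !exprS; apply: (@le_trans _ _ ((1 + y) * (1 + (2 ^+ w - 1) * y))).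
  by rewrite ler_wpM2l //; lra.
have : 0 <= (2 ^+ w - 1) * (y * (1 - y)) by rewrite !mulr_ge0 ?subr_ge0.
by move: w1; set a := 2 ^+ w => w1; nra.
Qed.

Lemma expr23_le (w : nat) : (0 < w)%N -> (2 / 3) ^+ w <= 2 / w%:R :> R.
Proof.
move=> w0; have wR : 0 < w%:R :> R by rewrite ltr0n.
have B : 1 + w%:R / 2 <= (3 / 2) ^+ w :> R.
  elim: w {w0 wR} => [|w IH]; first by rewrite expr0; lra.
  by rewrite exprS -natr1; have : 0 <= w%:R :> R by []; nra.
rewrite (_ : 2 / 3 = (3 / 2)^-1 :> R); last by rewrite invf_div.
rewrite exprVn -(invf_div w%:R) lef_pV2 ?posrE; [lra| |lra].
by apply: exprn_gt0; lra.
Qed.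

Lemma trunc_log_le_ln (n : nat) : (0 < n)%N ->
  (trunc_log 2 n)%:R <= 2 * ln (n%:R : R).
Proof.
move=> n0.
have ln2 : 2^-1 <= ln (2 : R).
  (* From [ln (1 - 1/2) <= - 1/2]. *)
  have := @le_ln1Dx R (- 2^-1); rewrite (_ : 1 - 2^-1 = 2^-1); last by lra.
  by rewrite lnV ?posrE // => H; have := H ltac:(lra); lra.
have : ln ((2 ^ trunc_log 2 n)%:R : R) <= ln n%:R.
  by rewrite ler_ln ?posrE ?ltr0n ?expn_gt0 // ler_nat trunc_logP.
rewrite natrX lnXn // -[_ *+ trunc_log _ _]mulr_natr.
have : 2^-1 * (trunc_log 2 n)%:R <= ln 2 * (trunc_log 2 n)%:R :> R.
  by rewrite ler_wpM2r.
by lra.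
Qed.

(** With [L = ln n], squaring [exp (eps L / 2) >= eps L / 2] gives [n^eps >= eps^2 L^2 / 4], and
    [936 = 4 * 234]. The value [234 = 39 * 6] serves the case of maximum degree at most 6. *)
Lemma powR_ge_ln (n : nat) (eps : R) : (0 < n)%N -> 0 < eps ->
  936 / eps ^+ 2 <= ln (n%:R : R) -> 234 * ln (n%:R : R) <= powR n%:R eps.
Proof.
move=> n0 e0 L1; set L := ln _ in L1 *.
have e2 : 0 < eps ^+ 2 by rewrite exprn_gt0.
rewrite ler_pdivrMr // in L1.
have L0 : 0 < L by nra.
rewrite /powR gt_eqF ?ltr0n // -/L.
have -> : eps * L = eps * L / 2 + eps * L / 2 by lra.
rewrite expRD.
have := expR_ge1Dx (eps * L / 2).
have eL : 0 < eps * L by rewrite mulr_gt0.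
set z := sequences.expR _ => zz.
have : (eps * L / 2) ^+ 2 <= z * z by rewrite -expr2 lerXn2r ?nnegrE; lra.
rewrite (_ : (eps * L / 2) ^+ 2 = L * (L * eps ^+ 2) / 4); last by field.
have : L * 936 <= L * (L * eps ^+ 2) by rewrite ler_pM2l.
lra.
Qed.

End Numerics.

(** * Choice of the constants and conclusion *)

Theorem theorem1 (R : realType) (eps : R) (heps : 0 < eps < 1)
    (eta : R) (heta : 0 < eta) :
  exists n0 : nat, forall n : nat, (n0 <= n)%N ->
  forall (V : finType) (T : sgraph V), #|V| = n -> tree T ->
  forall p : R, 0 <= p <= 1 ->
    40 / eps * (max_degree T)%:R * ln (n%:R : R) + powR n%:R eps <= n%:R * p ->
    1 - eta <= gnp_prob p (fun G : sgraph 'I_n => contains_copy T G).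
Proof.
have /andP[e0 e1] := heps.
(* Then [3 * (2 / 3) ^+ w <= 6 / w <= eta / 2] bounds the error of all halving rounds. *)
have [w w2 wR] : exists2 w : nat, (2 <= w)%N & 12 / eta <= w%:R.
  exists (Num.Def.archi_bound (12 / eta)).+2 => //.
  have := archi_boundP (divr_ge0 (ler0n R 12) (ltW heta)).
  by rewrite -[_.+2]addn2 natrD; lra.
have w0 : (0 < w)%N by apply: ltn_trans w2.
have wR0 : 0 < w%:R :> R by rewrite ltr0n.
(* Each summand is a lower bound needed for [ln n]: for [1 / L <= 1], for a last-round error of at
   most [eta / 2], and for [powR_ge_ln]. *)
pose C : R := 1 + 2 ^+ w.+1 / eta + 936 / eps ^+ 2.
exists (Num.trunc (sequences.expR C)).+1 => n nC V T cardV [_ acT].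
move=> p /andP[p0 p1] hp.
have Cn : sequences.expR C < n%:R.
  by apply: lt_le_trans (truncnS_gt _) _; rewrite ler_nat.
have nR : 0 < n%:R :> R by apply: lt_trans Cn; apply: expR_gt0.
have n0 : (0 < n)%N by rewrite -(ltr0n R).
set L := ln n%:R in hp.
have CL : C < L by rewrite -(expRK C) ltr_ln ?posrE ?expR_gt0.
have C1 : 0 <= 2 ^+ w.+1 / eta by rewrite divr_ge0 ?exprn_ge0 // ltW.
have C2 : 0 <= 936 / eps ^+ 2 by rewrite divr_ge0 ?exprn_ge0 // ltW.
have L1 : 1 <= L by rewrite /C in CL; lra.
have Leta : 2 ^+ w.+1 / eta <= L by rewrite /C in CL; lra.
have Leps : 936 / eps ^+ 2 <= L by rewrite /C in CL; lra.
pose D := maxn (max_degree T) 6.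
have D0 : 0 < D%:R :> R by rewrite ltr0n (leq_trans _ (leq_maxr _ _)).
have hpD : 39 * D%:R * L <= n%:R * p.
  apply: le_trans hp; have pow : 234 * L <= _ := powR_ge_ln n0 e0 Leps.
  have e40 : 40 <= 40 / eps by rewrite ler_pdivlMr //; lra.
  have d0 : 0 <= (max_degree T)%:R * L by rewrite mulr_ge0 //; lra.
  rewrite /D; have [d6|d6] := leqP (max_degree T) 6.
    have : 0 <= 40 / eps * (max_degree T)%:R * L by rewrite -mulrA mulr_ge0 //; lra.
    by lra.
  rewrite -!mulrA.
  have : 40 * ((max_degree T)%:R * L) <= 40 / eps * ((max_degree T)%:R * L).
    by rewrite ler_wpM2r.
  by lra.
(* The last-round density makes [c / t = 1 / L]; with at most [2 L] rounds of density [18 D / n] the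
   total is at most [39 D L / n]. *)
have t0 : 0 < 3 * D%:R * L / n%:R by rewrite divr_gt0 // !mulr_gt0 //; lra.
have JL : (trunc_log 2 n)%:R <= 2 * L := trunc_log_le_ln R n0.
apply: le_trans (contains_copy_prob (D := D) (J := trunc_log 2 n) (w := w)
  cardV acT _ _ n0 w0 _ t0 p1 _); rewrite ?leq_maxl ?leq_maxr //.
- have -> : 3 * D%:R / n%:R / (3 * D%:R * L / n%:R) = L^-1.
    by field; apply/and3P; split; apply: lt0r_neq0; lra.
  rewrite lerD2l lerN2.
  have H1 : (1 + L^-1) ^+ w - 1 <= eta / 2.
    apply: le_trans (expr1D_sub1_le _ _) _.
      by rewrite invr_ge0 invf_le1; lra.
    rewrite ler_pdivrMr //; last by lra.
    by move: Leta; rewrite ler_pdivrMr // exprS; lra.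
  have x0 : 0 <= (2 / 3) ^+ w :> R by apply: exprn_ge0; lra.
  have x1 : (2 / 3) ^+ w <= 2 / 3 :> R by rewrite -[leRHS]expr1 ler_wiXn2l //; lra.
  have := sum_tower_le (trunc_log 2 n) x0 x1.
  under eq_bigr do rewrite -exprM.
  have H3 : 2 / w%:R <= eta / 6.
    rewrite ler_pdivrMr //; move: wR; rewrite ler_pdivrMr //; lra.
  by have := expr23_le R w0; lra.
(* The rounded-down logarithm only gives [n < 2 * 2 ^ J]; the missing factor 2 comes from
   [2 <= w]. *)
- have := trunc_log_ltn n (isT : (1 < 2)%N); rewrite expnS => /ltnW/leq_trans; apply.
  by rewrite leq_mul2r w2 orbT.
- rewrite -(ler_pM2l nR); apply: le_trans hpD.
  have -> : n%:R * ((trunc_log 2 n)%:R * (18 * D%:R / n%:R) + 3 * D%:R * L / n%:R)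
     = 18 * ((trunc_log 2 n)%:R * D%:R) + 3 * (D%:R * L).
    by field; apply: lt0r_neq0.
  have : (trunc_log 2 n)%:R * D%:R <= 2 * L * D%:R by rewrite ler_pM2r.
  by lra.
Qed.
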